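(* Let $\Omega$ be a finite interval $(a,b)$ or $\mathbb{R}$, let $\alpha>0$, let $K\subset\Omega$ be compact, and suppose $u\in\mathscr{D}'_K(\Omega)$. Then: (i) ${}^{\pm}\mathcal{D}^{\alpha}u\in\mathscr{D}'(\Omega)$. Moreover, if $K\subseteq[c,d]\subset\subset\Omega$, then $\operatorname{supp}({}^{-}\mathcal{D}^{\alpha}u)\subseteq[c,\infty)\cap\Omega$ and $\operatorname{supp}({}^{+}\mathcal{D}^{\alpha}u)\subseteq(-\infty,d]\cap\Omega$. (ii) If $\{u_j\}_{j=1}^\infty\subset\mathscr{D}'_K(\Omega)$ is such that $u_j\to u$ in $\mathscr{D}'_K(\Omega)$, then ${}^{\pm}\mathcal{D}^{\alpha}u_j\to{}^{\pm}\mathcal{D}^{\alpha}u$ in $\mathscr{D}'(\Omega)$.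
   Context: $\mathscr{D}(\Omega)=C_0^\infty(\Omega)$ with the usual convergence: $\varphi_k\to\varphi$ if all $\varphi_k$ are supported in a common compact subset of $\Omega$ and all derivatives converge uniformly. $\mathscr{D}'(\Omega)$ is the space of continuous linear functionals on $\mathscr{D}(\Omega)$ (distributions), and $\mathscr{D}'_K(\Omega)=\{u\in\mathscr{D}'(\Omega):\operatorname{supp}(u)\subseteq K\}$. Convergence $u_j\to u$ in $\mathscr{D}'(\Omega)$ or $\mathscr{D}'_K(\Omega)$ means $u_j(\varphi)\to u(\varphi)$ for each $\varphi\in\mathscr{D}(\Omega)$. Put $a^*=a,b^*=b$ if $\Omega=(a,b)$ and $a^*=-\infty,b^*=\infty$ if $\Omega=\mathbb{R}$. For $\sigma>0$: ${}^{-}I^{\sigma}f(x)=\frac{1}{\Gamma(\sigma)}\int_{a^*}^x\frac{f(y)}{(x-y)^{1-\sigma}}\,dy$, ${}^{+}I^{\sigma}f(x)=\frac{1}{\Gamma(\sigma)}\int_x^{b^*}\frac{f(y)}{(y-x)^{1-\sigma}}\,dy$. For $n-1<\alpha<n$ ($n\in\mathbb{N}$): ${}^{-}D^{\alpha}\varphi=\frac{d^n}{dx^n}\,{}^{-}I^{n-\alpha}\varphi$, ${}^{+}D^{\alpha}\varphi=(-1)^n\frac{d^n}{dx^n}\,{}^{+}I^{n-\alpha}\varphi$; for integer $\alpha$, ${}^{\pm}D^{\alpha}$ is the ordinary derivative of order $\alpha$. Weak fractional derivatives of $u\in\mathscr{D}'_K(\Omega)$: with $[\alpha]$ the integer part of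 $\alpha$ and $\psi\in C_0^\infty(\Omega)$ any function with $\psi\equiv1$ on a neighbourhood of $K$, $${}^{-}\mathcal{D}^{\alpha}u(\varphi)=(-1)^{[\alpha]}u(\psi\,{}^{+}D^{\alpha}\varphi),\qquad{}^{+}\mathcal{D}^{\alpha}u(\varphi)=(-1)^{[\alpha]}u(\psi\,{}^{-}D^{\alpha}\varphi)\qquad\forall\varphi\in\mathscr{D}(\Omega);$$ this does not depend on the choice of $\psi$. *)

(* Defs.v *)
From HB Require Import structures.
From mathcomp Require Import all_boot all_order all_algebra.
From mathcomp Require Import all_classical all_reals all_analysis.

Set Implicit Arguments.
Unset Strict Implicit.
Unset Printing Implicit Defensive.

Import Order.TTheory GRing.Theory Num.Theory.
Import numFieldNormedType.Exports.

Local Open Scope ring_scope.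
Local Open Scope classical_set_scope.

Variant domain (R : realType) :=
| FiniteInterval (a b : R) of a < b
| WholeLine.

Arguments FiniteInterval {R} a b _.
Arguments WholeLine {R}.

Section FractionalDerivatives.
Context {R : realType}.
Implicit Types (Omega : domain R) (K : set R) (sigma alpha x : R).
Implicit Types (f phi psi : R -> R) (u v : (R -> R) -> R).

Definition dom_set Omega : set R :=
  match Omega with
  | FiniteInterval a b _ => `]a, b[
  | WholeLine => setT
  end.

(* A test function on Omega is represented by its extension by zero to the
   real line. *)
Definition fsupp f : set R := closure [set x | f x != 0].

Definition smooth f := forall n x, derivable (f^`(n)) x 1.

Definition testfun Omega phi :=
  [/\ smooth phi, compact (fsupp phi) & fsupp phi `<=` dom_set Omega].

Definition testfun_cvg Omega (phi_ : nat -> R -> R) phi :=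
  (exists C : set R,
     [/\ compact C, C `<=` dom_set Omega & forall k, fsupp (phi_ k) `<=` C])
  /\ forall n, {uniform setT, (fun k => (phi_ k)^`(n)) @ \oo --> phi^`(n)}.

(* Functionals are total maps on R -> R, of which only the values at test
   functions matter: every property below is about those values only.
   A term such as u (psi * g) thus carries information about u only once
   psi * g is known to be a test function. *)
Definition is_distribution Omega u :=
  (forall (k : R) phi chi, testfun Omega phi -> testfun Omega chi ->
     u (fun x => k * phi x + chi x) = k * u phi + u chi)
  /\ (forall (phi_ : nat -> R -> R) phi,
       (forall k, testfun Omega (phi_ k)) -> testfun Omega phi ->
       testfun_cvg Omega phi_ phi ->
       (fun k => u (phi_ k)) @ \oo --> u phi).

Definition vanishes_on Omega u (V : set R) :=
  forall phi, testfun Omega phi -> fsupp phi `<=` V -> u phi = 0.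

Definition dsupp Omega u : set R :=
  dom_set Omega `\` \bigcup_(V in [set V | open V /\ vanishes_on Omega u V]) V.

Definition is_distribution_on Omega K u :=
  is_distribution Omega u /\ dsupp Omega u `<=` K.

Definition distribution_cvg Omega (u_ : nat -> (R -> R) -> R) u :=
  forall phi, testfun Omega phi -> (fun j => u_ j phi) @ \oo --> u phi.

Definition Gamma sigma : R :=
  \int[lebesgue_measure]_(t in `]0, +oo[) (t `^ (sigma - 1) * expR (- t)).

(* The integration ranges ]a*, x[ and ]x, b*[. *)
Definition left_range Omega x : set R :=
  match Omega with
  | FiniteInterval a _ _ => `]a, x[
  | WholeLine => `]-oo, x[
  end.

Definition right_range Omega x : set R :=
  match Omega with
  | FiniteInterval _ b _ => `]x, b[
  | WholeLine => `]x, +oo[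
  end.

Definition left_int Omega sigma f x : R :=
  (Gamma sigma)^-1 *
  \int[lebesgue_measure]_(y in left_range Omega x)
     (f y / (x - y) `^ (1 - sigma)).

Definition right_int Omega sigma f x : R :=
  (Gamma sigma)^-1 *
  \int[lebesgue_measure]_(y in right_range Omega x)
     (f y / (y - x) `^ (1 - sigma)).

(* For non-integer alpha > 0, the n with n - 1 < alpha < n is
   (Num.truncn alpha).+1. *)
Definition left_der Omega alpha phi : R -> R :=
  if alpha \is a Num.nat then phi^`(Num.truncn alpha)
  else let n := (Num.truncn alpha).+1 in
       (left_int Omega (n%:R - alpha) phi)^`(n).

(* For integer alpha, both one-sided derivatives are the ordinary derivative,
   without any sign. *)
Definition right_der Omega alpha phi : R -> R :=
  if alpha \is a Num.nat then phi^`(Num.truncn alpha)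
  else let n := (Num.truncn alpha).+1 in
       (-1) ^+ n \*o (right_int Omega (n%:R - alpha) phi)^`(n)%classic.

Definition cutoff Omega K psi :=
  testfun Omega psi /\
  exists U : set R, [/\ open U, K `<=` U & forall x, U x -> psi x = 1].

(* The weak derivatives, computed with the cutoff psi. *)
Definition left_weak_der Omega psi alpha u : (R -> R) -> R :=
  fun phi => (-1) ^+ Num.truncn alpha *
             u (fun x => psi x * right_der Omega alpha phi x).

Definition right_weak_der Omega psi alpha u : (R -> R) -> R :=
  fun phi => (-1) ^+ Num.truncn alpha *
             u (fun x => psi x * left_der Omega alpha phi x).

End FractionalDerivatives.

(* Main.v *)
(* On test functions the one-sided fractional integral agrees locally with the
   truncated integral [weyl f x = int_0^N f (x + s t) t^-beta dt], where
   [s = 1] or [s = -1], [beta < 1], and [N] depends only on the support of [f]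
   and on the range of [x].  As [t^-beta] is integrable on [0, N], this operator
   is bounded for the sup norm and commutes with differentiation, so that
   [phi |-> psi * D^alpha phi] maps test functions to test functions continuously.
   This gives (i) and (ii) up to the supports.

   If [phi] vanishes on the right of [c], so does its right derivative, hence
   [psi * D^alpha phi] is supported away from [K].  That [u] then kills it is a
   partition of unity argument, where the smooth step functions are the
   normalised primitives of [phi ^+ 2] for a nonzero test function [phi]. *)

Require Import Defs.
From mathcomp Require Import all_boot all_order all_algebra.
From mathcomp Require Import all_classical all_reals all_analysis.
From mathcomp Require Import measurable_realfun ring lra.
Import Order.TTheory GRing.Theory Num.Theory.
Import numFieldNormedType.Exports.
Local Open Scope ring_scope.
Local Open Scope classical_set_scope.

Set Implicit Arguments.
Unset Strict Implicit.
Unset Printing Implicit Defensive.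

(** * Uniform convergence and smoothness in elementary terms *)

Lemma uniform_cvgP (R : realType) (A : set R) (f_ : nat -> R -> R) (f : R -> R) :
  {uniform A, f_ @ \oo --> f} <->
  (forall e : R, 0 < e -> \forall k \near \oo, forall x, A x -> `|f_ k x - f x| < e).
Proof.
split=> [cf e e0|cf P /uniform_nbhs[E []]].
- have := cf [set h | forall x, A x -> `|h x - f x| < e].
  apply; apply/uniform_nbhs.
  exists [set xy | ball xy.1 e xy.2]; split.
    by rewrite -entourage_ballE; exists e.
  by move=> h /= hf x Ax; rewrite distrC; exact: hf.
- rewrite -entourage_ballE => -[e /= e0 eE] EP.
  near=> k; apply: EP => x Ax; apply: eE => /=.
  by rewrite -ball_normE /= distrC; move: x Ax; near: k; exact: cf.
Unshelve. all: by end_near. Qed.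

(** Gives access to the definition of [smooth] after it has been made opaque. *)
Lemma smoothP (R : realType) (f : R -> R) :
  smooth f <-> forall n x, derivable (f^`(n)) x 1.
Proof. by []. Qed.

(* Otherwise [done] unfolds [smooth] and unifies iterated derivatives, which is
   very slow. *)
Local Opaque smooth derive1 derivable.

(** * Calculus of smooth functions on the line *)

Section smooth_functions.
Context {R : realType}.
Implicit Types f g : R -> R.

Lemma smooth_derivablen f n x : smooth f -> derivable (f^`(n)) x 1.
Proof. by move/smoothP; exact. Qed.

Arguments smooth_derivablen {f} n x _.

Lemma smooth_derivable f x : smooth f -> derivable f x 1.
Proof. exact: (@smooth_derivablen f 0). Qed.

Lemma smooth_continuous f : smooth f -> continuous f.
Proof.
move=> sf x; apply: differentiable_continuous; apply/derivable1_diffP.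
exact: smooth_derivable.
Qed.

Lemma smooth_derive1 f : smooth f -> smooth (derive1 f).
Proof.
by move=> sf; apply/smoothP => n x; rewrite -derive1Sn; exact: smooth_derivablen.
Qed.

Lemma smooth_derive1n f n : smooth f -> smooth (derive1n n f).
Proof.
move=> sf; elim: n => [|n ih]; first exact: sf.
by rewrite derive1nS; apply: smooth_derive1.
Qed.

Lemma smoothS f : (forall x, derivable f x 1) -> smooth (derive1 f) -> smooth f.
Proof.
move=> df sf; apply/smoothP => -[|n] x; first exact: df.
by rewrite derive1Sn; exact: smooth_derivablen.
Qed.

Lemma derive1D f g x : derivable f x 1 -> derivable g x 1 ->
  derive1 (f \+ g) x = derive1 f x + derive1 g x.
Proof.
move=> df dg; rewrite (derive1E f) (derive1E g) (derive1E (f \+ g)).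
exact: (deriveD df dg).
Qed.

(** Assumes differentiability only below order [n], because [smoothM] applies it to products whose
    smoothness is still being proved. *)
Lemma derive1nD_lt n f g :
  (forall k x, (k < n)%N -> derivable (derive1n k f) x 1) ->
  (forall k x, (k < n)%N -> derivable (derive1n k g) x 1) ->
  derive1n n (f \+ g) = derive1n n f \+ derive1n n g.
Proof.
elim: n => [_ _|n ih df dg]; first exact: erefl.
have := ih (fun k x kn => df k x (ltnW kn)) (fun k x kn => dg k x (ltnW kn)).
rewrite (derive1nS (f \+ g)) => ->.
by apply/funext => x; exact: (derive1D (df n x (ltnSn n)) (dg n x (ltnSn n))).
Qed.

Lemma derive1nD n f g : smooth f -> smooth g ->
  derive1n n (f \+ g) = derive1n n f \+ derive1n n g.
Proof.
by move=> sf sg; apply: derive1nD_lt => k x _; exact: smooth_derivablen.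
Qed.

Arguments derive1nD n {f g}.

Lemma smoothD f g : smooth f -> smooth g -> smooth (f \+ g).
Proof.
move=> sf sg; apply/smoothP => n x; rewrite (derive1nD n sf sg).
exact: (derivableD (smooth_derivablen n x sf) (smooth_derivablen n x sg)).
Qed.

Lemma derive1nZ (k : R) n f : smooth f ->
  derive1n n (k \*o f) = k \*o derive1n n f.
Proof.
move=> sf; elim: n => [|n ih]; first exact: erefl.
rewrite (derive1nS (k \*o f)) ih; apply/funext => x.
exact: (derive1Ml _ (smooth_derivablen n x sf)).
Qed.

Arguments derive1nZ k n {f}.

Lemma smoothZ (k : R) f : smooth f -> smooth (k \*o f).
Proof.
move=> sf; apply/smoothP => n x; rewrite (derive1nZ k n sf).
exact: (derivableZ (smooth_derivablen n x sf)).
Qed.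

Let subfE f g : f \- g = f \+ (-1 \*o g).
Proof. by apply/funext => x /=; rewrite mulN1r. Qed.

Lemma derive1nB n f g : smooth f -> smooth g ->
  derive1n n (f \- g) = derive1n n f \- derive1n n g.
Proof.
move=> sf sg; rewrite (subfE f) (subfE (derive1n n f)) -(derive1nZ (-1) n sg).
exact: (derive1nD n sf (smoothZ (k := -1) sg)).
Qed.

Arguments derive1nB n {f g}.

Lemma smoothB f g : smooth f -> smooth g -> smooth (f \- g).
Proof.
by move=> sf sg; rewrite subfE; exact: (smoothD sf (smoothZ (k := -1) sg)).
Qed.

Lemma derivable_mul f g x : derivable f x 1 -> derivable g x 1 ->
  derivable (f \* g) x 1.
Proof. exact: derivableM. Qed.

Lemma derive1_mul f g :
  (forall x, derivable f x 1) -> (forall x, derivable g x 1) ->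
  derive1 (f \* g) = (derive1 f \* g) \+ (f \* derive1 g).
Proof.
move=> df dg; apply/funext => x.
rewrite [LHS]derive1E [LHS](deriveM (df x) (dg x)) -(derive1E f) -(derive1E g).
by rewrite [LHS]addrC [X in X + _ = _]mulrC.
Qed.

Let derive1_mul_smooth f g : smooth f -> smooth g ->
  derive1 (f \* g) = (derive1 f \* g) \+ (f \* derive1 g).
Proof. by move=> sf sg; apply: derive1_mul => x; exact: smooth_derivable. Qed.

(** Strong induction on the order of differentiation, for all pairs of smooth functions at once: by
    the product rule the first derivative is a sum of two products of smooth functions, to which the
    lower orders apply. *)
Lemma smoothM f g : smooth f -> smooth g -> smooth (f \* g).
Proof.
move=> sf0 sg0; apply/smoothP => n; move: f g sf0 sg0.
elim/ltn_ind: n => -[|n] ih f g sf sg x.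
  by apply: derivable_mul; exact: smooth_derivable.
have sf' := smooth_derive1 sf; have sg' := smooth_derive1 sg.
rewrite derive1Sn (derive1_mul_smooth sf sg).
rewrite (derive1nD_lt (fun k y kn => ih k (ltnW kn) _ _ sf' sg y)
                      (fun k y kn => ih k (ltnW kn) _ _ sf sg' y)).
exact: (derivableD (ih n (ltnSn n) _ _ sf' sg x) (ih n (ltnSn n) _ _ sf sg' x)).
Qed.

Lemma derive1n_mulS f g n : smooth f -> smooth g ->
  derive1n n.+1 (f \* g) =
  derive1n n (derive1 f \* g) \+ derive1n n (f \* derive1 g).
Proof.
move=> sf sg; rewrite derive1Sn (derive1_mul_smooth sf sg).
exact: (derive1nD n (smoothM (smooth_derive1 sf) sg)
  (smoothM sf (smooth_derive1 sg))).
Qed.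

Lemma derive1n_cst0 n : derive1n n (fun=> 0 : R) = (fun=> 0 : R).
Proof.
elim: n => [|n ih]; first exact: erefl.
by rewrite derive1nS ih; apply/funext => x; exact: derive1_cst.
Qed.

Lemma smooth_cst (k : R) : smooth (fun=> k).
Proof.
apply: smoothS => [x|]; first exact: derivable_cst.
have -> : derive1 (fun=> k) = (fun=> 0) by apply/funext => x; exact: derive1_cst.
apply/smoothP => n x; rewrite derive1n_cst0; exact: derivable_cst.
Qed.

Lemma is_derive_affine (l m x : R) : is_derive x 1 (fun y : R => l * y + m) l.
Proof.
apply: (is_derive_eq (is_deriveD (is_deriveZ l (is_derive_id x 1)) (is_derive_cst m x 1))).
by rewrite addr0 /GRing.scale/= mulr1.
Qed.

Lemma derivable_affine f (l m x : R) : derivable f (l * x + m) 1 ->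
  derivable (fun y => f (l * y + m)) x 1.
Proof.
move=> /derivable1_diffP df; apply/derivable1_diffP.
apply: (differentiable_comp (f := fun y : R => l * y + m)); last exact: df.
by apply/derivable1_diffP; have [] := is_derive_affine l m x.
Qed.

Lemma derive1_affine f (l m x : R) : derivable f (l * x + m) 1 ->
  derive1 (fun y => f (l * y + m)) x = l * derive1 f (l * x + m).
Proof.
move=> df; have [da ea] := is_derive_affine l m x.
rewrite [LHS](derive1_comp (f := fun y : R => l * y + m) da df).
by rewrite [X in _ * X]derive1E ea mulrC.
Qed.

Lemma derive1n_affine f (l m : R) n : smooth f ->
  derive1n n (fun y => f (l * y + m)) =
  (fun y => l ^+ n * derive1n n f (l * y + m)).
Proof.
move=> sf; elim: n => [|n ih]; first by apply/funext => y /=; rewrite mul1r.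
have df y : derivable (derive1n n f) y 1 by exact: smooth_derivablen.
rewrite derive1nS ih; apply/funext => y.
rewrite [LHS](derive1Ml _ (derivable_affine (df _))) (derive1_affine (df _)).
by rewrite mulrA exprSr derive1nS.
Qed.

Arguments derive1n_affine {f} l m n.

Lemma smooth_affine f (l m : R) : smooth f -> smooth (fun y => f (l * y + m)).
Proof.
move=> sf; apply/smoothP => n x; rewrite (derive1n_affine l m n sf).
exact: (derivableZ (derivable_affine (smooth_derivablen n _ sf))).
Qed.

Lemma derive1_near f g x : (\near x, f x = g x) -> derive1 f x = derive1 g x.
Proof. by move=> fg; rewrite (derive1E f) (derive1E g); exact: near_eq_derive. Qed.

Lemma derive1n_open (V : set R) f g n : open V -> (forall x, V x -> f x = g x) ->
  forall x, V x -> derive1n n f x = derive1n n g x.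
Proof.
move=> oV fg; elim: n => [|n ih] x Vx; first exact: fg.
rewrite (derive1nS f) (derive1nS g); apply: derive1_near.
by near do apply: ih; exact: open_nbhs_nbhs.
Unshelve. all: by end_near. Qed.

Lemma derivable_open (V : set R) f g x : open V -> (forall x, V x -> f x = g x) ->
  V x -> derivable g x 1 -> derivable f x 1.
Proof.
move=> oV fg Vx; apply: near_eq_derivable.
by near do apply/esym/fg; exact: open_nbhs_nbhs.
Unshelve. all: by end_near. Qed.

Lemma derive1n_eq0 (V : set R) f n : open V -> (forall x, V x -> f x = 0) ->
  forall x, V x -> derive1n n f x = 0.
Proof.
by move=> oV f0 x Vx; rewrite (derive1n_open (g := fun=> 0) n oV f0 Vx) derive1n_cst0.
Qed.

End smooth_functions.

(** * Bounds on compact sets, multiplication by a cutoff, and smooth steps *)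

Section compact_support.
Context {R : realType}.
Implicit Types f g : R -> R.

Lemma continuous_segment_bound f (X : R) : continuous f ->
  exists B : R, 0 < B /\ forall x, `|x| <= X -> `|f x| <= B.
Proof.
move=> cf; have : compact (f @` `[- X, X]).
  by apply: continuous_compact; [exact: continuous_subspaceT|exact: segment_compact].
move/compact_bounded => [B [_ hB]]; exists (`|B| + 1); split.
  by rewrite ltr_wpDl.
move=> x xX; apply: (hB (`|B| + 1)).
  by rewrite (le_lt_trans (ler_norm B))// ltrDl.
by exists x => //=; rewrite in_itv/= -ler_norml.
Qed.

Lemma open_norm_gt (X : R) : open [set x : R | X < `|x|].
Proof.
rewrite (_ : [set x : R | X < `|x|] = Num.norm @^-1` `]X, +oo[); last first.
  by apply/seteqP; split=> x /=; rewrite in_itv/= andbT.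
by apply: open_comp; [move=> x _; exact: norm_continuous|exact: interval_open].
Qed.

(** A cutoff turns uniform convergence on [[-X, X]] into uniform convergence on the line. The
    induction on [n] uses the product rule and is general in [psi] and [h_]: [psi'] vanishes where
    [|x| > X] like [psi], and the derivatives of [h_ k] satisfy the same hypothesis. *)
Lemma derive1n_mul_cvg0 (X : R) (psi : R -> R) (h_ : nat -> R -> R) :
  smooth psi -> (forall x, X < `|x| -> psi x = 0) -> (forall k, smooth (h_ k)) ->
  (forall n (e : R), 0 < e -> \forall k \near \oo,
     forall x, `|x| <= X -> `|derive1n n (h_ k) x| < e) ->
  forall n (e : R), 0 < e -> \forall k \near \oo,
    forall x, `|derive1n n (psi \* h_ k) x| < e.
Proof.
move=> + + + + n; elim: n psi h_ => [|n ih] psi h_ spsi psi0 sh h0 e e0.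
  have [B [B0 psiB]] := continuous_segment_bound X (smooth_continuous spsi).
  have := h0 0%N (e / B) (divr_gt0 e0 B0); apply: filterS => k hk x /=.
  rewrite normrM; have [xX|Xx] := leP `|x| X; last by rewrite psi0// normr0 mul0r.
  have := hk x xX; rewrite ltr_pdivlMr//; apply: le_lt_trans.
  by rewrite mulrC ler_wpM2l// psiB.
have e20 : 0 < e / 2 by rewrite divr_gt0.
have psi'0 x : X < `|x| -> derive1 psi x = 0.
  exact: (derive1n_eq0 1 (@open_norm_gt X) psi0).
have := ih _ h_ (smooth_derive1 spsi) psi'0 sh h0 _ e20.
have h'0 m (d : R) : 0 < d -> \forall k \near \oo,
    forall x, `|x| <= X -> `|derive1n m (derive1 (h_ k)) x| < d.
  by move=> /(h0 m.+1); apply: filterS => k hk x /hk; rewrite derive1Sn.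
have := ih psi _ spsi psi0 (fun k => smooth_derive1 (sh k)) h'0 _ e20.
move=> /[swap]; apply: filterS2 => k h1 h2 x.
rewrite (derive1n_mulS n spsi (sh k)) /=.
by rewrite (le_lt_trans (ler_normD _ _))// (splitr e) ltrD.
Qed.

Lemma smooth_step_of_bump (phi : R -> R) (M x0 : R) : smooth phi ->
  (forall x, M <= `|x| -> phi x = 0) -> phi x0 != 0 ->
  exists H : R -> R, [/\ smooth H, forall x, x <= - M -> H x = 0
                      & forall x, M <= x -> H x = 1].
Proof.
move=> sphi phi0 phix0.
pose f := phi \* phi; have sf : smooth f by exact: smoothM.
have cf := smooth_continuous sf.
have f_ge0 x : 0 <= f x by rewrite /f /= -expr2 sqr_ge0.
have f0 x : M <= `|x| -> f x = 0 by move=> Mx; rewrite /f /= phi0// mulr0.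
pose G x : R := \int[lebesgue_measure]_(t in `]-oo, x]) f t.
(* Since [f] equals its restriction to [[- M, M]], integrability on an unbounded ray reduces to that
   of a continuous function on a compact segment. *)
have intf u : lebesgue_measure.-integrable `]-oo, u] (EFin \o f).
  have -> : EFin \o f = (EFin \o f) \_ `[- M, M].
    apply/funext => x; rewrite /patch; case: ifPn => //.
    rewrite notin_setE /= in_itv/= -ler_norml => /negP; rewrite -ltNge => Mx.
    by rewrite f0// ltW.
  have fM : lebesgue_measure.-integrable `[- M, M] (EFin \o f).
    apply: continuous_compact_integrable; first exact: segment_compact.
    exact: continuous_subspaceT.
  apply/integrable_restrict => //; apply: integrableS fM => //.
  exact: measurableI.
have dG x : derivable G x 1 /\ derive1 G x = f x.
  have xx1 : x < x + 1 by rewrite ltrDl.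
  by have := continuous_FTC1 xx1 (intf (x + 1)) (ltNyr x) (cf x).
have sG : smooth G.
  apply: smoothS => [x|]; first by case: (dG x).
  by have -> : derive1 G = f by apply/funext => x; case: (dG x).
have GNM x : x <= - M -> G x = 0.
  move=> xM; transitivity (\int[lebesgue_measure]_(t in `]-oo, x]) (0 : R)).
    apply: eq_Rintegral => t; rewrite inE/= in_itv/= => tx; apply: f0.
    by rewrite -normrN (le_trans _ (ler_norm _))// lerNr (le_trans tx).
  by rewrite Rintegral_cst// mul0r.
have GM x : M <= x -> G x = G M.
  move=> Mx; rewrite /G Rintegral_mkcond [RHS]Rintegral_mkcond.
  congr Rintegral; apply/funext => t; rewrite /patch.
  have [tM|Mt] := leP t M; first by rewrite !mem_set//= in_itv/= ?(le_trans tM).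
  by rewrite (f0 t) ?(le_trans (ltW Mt)) ?ler_norm//; do 2 case: ifPn.
have Gle x y : x <= y -> G x <= G y.
  apply: (ger0_derive1_ndecry _ _ _ (lexx x)) => [z _|z _|].
  - by case: (dG z).
  - by case: (dG z) => _ ->.
  - exact: (continuous_subspaceT (smooth_continuous sG)).
(* With total mass zero, the nondecreasing function [G] would vanish identically, and so would its
   derivative [phi ^+ 2], against [phi x0 != 0]. *)
have GM0 : 0 < G M.
  rewrite lt_neqAle Rintegral_ge0// andbT; apply/eqP => GM0.
  have G0 : G = cst 0.
    apply/funext => y; apply/eqP; rewrite eq_le Rintegral_ge0// andbT.
    by have [yM|/ltW My] := leP y M; rewrite GM0; [exact: Gle|rewrite GM].
  move: phix0; have [_] := dG x0; rewrite G0 [LHS]derive1_cst => /esym/eqP.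
  by rewrite /f /= mulf_eq0 orbb => ->.
exists ((G M)^-1 \*o G); split; first exact: smoothZ.
- by move=> x xM /=; rewrite (GNM x)// mulr0.
- by move=> x Mx /=; rewrite (GM x)// mulVf// gt_eqF.
Qed.

End compact_support.

(** * Isometries of the line and the truncated Weyl integral *)

(** Lebesgue measure is determined by its values on the intervals []a, b]]. As [s] is 1 or -1, the
    preimage of such an interval is a translate of it, or a reflected interval closed on the left,
    of the same length in both cases. *)
Lemma lebesgue_measure_isometry (R : realType) (s x : R) : s ^+ 2 = 1 ->
  forall A : set R, measurable A ->
  pushforward lebesgue_measure
    ((fun t => x + s * t) : measurableTypeR R -> measurableTypeR R) A =
  lebesgue_measure A.
Proof.
move=> s2; pose T := (fun t => x + s * t) : measurableTypeR R -> measurableTypeR R.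
have mT : measurable_fun setT T.
  by apply: measurable_funD => //; exact: measurable_funM.
move=> A mA; apply/esym/lebesgue_measure_unique => //= _ [[a b]] _ <-.
rewrite /pushforward -/T.
have /orP[/eqP s1|/eqP s1] : (s == 1) || (s == -1) by rewrite -sqrf_eq1 s2.
- have -> : T @^-1` `]a, b] = `]a - x, b - x]%classic.
    by apply/seteqP; split=> t /=; rewrite /T s1 mul1r !in_itv/= ltrBlDl lerBrDl.
  by rewrite !lebesgue_measure_itv/= !lte_fin ltrD2r -!EFinD opprB addrA subrK.
- have -> : T @^-1` `]a, b] = `[x - b, x - a[%classic.
    apply/seteqP; split=> t /=; rewrite /T s1 mulN1r !in_itv/=.
      by rewrite ltrBrDl lerBlDl; lra.
    by lra.
  rewrite !lebesgue_measure_itv/= !lte_fin ltrD2l ltrN2 -!EFinD.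
  by congr (if _ then _%:E else _); lra.
Qed.

Lemma integrableZ_EFin (R : realType) d (T : measurableType d)
    (mu : {measure set T -> \bar R}) (D : set T) (k : R) (f : T -> R) :
  measurable D -> mu.-integrable D (EFin \o f) ->
  mu.-integrable D (EFin \o (fun t => k * f t)).
Proof. by move=> mD intf; exact: (integrableZl mD k intf). Qed.

Section weyl_integral.
Context {R : realType}.
Variables (beta s N : R).
Hypotheses (beta1 : beta < 1) (s2 : s ^+ 2 = 1) (N0 : 0 < N).
Implicit Types f g : R -> R.

(** Exhaust []0, N]] by the segments [[a n, N]]. On each of them the integral is [F N - F (a n)] for
    the primitive [F] of the kernel, hence at most [F N] because [beta < 1] makes [F] nonnegative;
    monotone convergence passes this bound to the limit. *)
Lemma integrable_powR_inv :
  lebesgue_measure.-integrable `]0, N] (EFin \o (fun t : R => (t `^ beta)^-1)).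
Proof.
have -> : (fun t : R => (t `^ beta)^-1) = (@powR R ^~ (- beta)).
  by apply/funext => t; rewrite powRN.
apply/integrableP; split.
  by apply/measurable_EFinP; apply: measurable_funTS; exact: measurable_powR.
(* The denominators start at 2, so that [a n < N] strictly, as the fundamental theorem of calculus
   requires. *)
pose a n : R := N / n.+2%:R.
have a0 n : 0 < a n by rewrite divr_gt0.
have aN n : a n < N by rewrite ltr_pdivrMr// ltr_pMr// ltr1n.
pose F t : R := (1 - beta)^-1 * t `^ (1 - beta).
have b10 : 1 - beta != 0 by rewrite subr_eq0 gt_eqF.
have dF (t : R) : 0 < t -> is_derive t 1 F (t `^ (- beta)).
  move=> t0; have dp := is_derive1_powR (1 - beta) t0.
  have -> : F = (1 - beta)^-1 \*: (@powR R ^~ (1 - beta)) by [].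
  by apply: is_derive_eq; rewrite /GRing.scale/= mulKf// addrAC subrr add0r.
have cF (t : R) : 0 < t -> {for t, continuous F}.
  move=> t0; apply: differentiable_continuous; apply/derivable1_diffP.
  by case: (dF t t0).
have intF n : (\int[lebesgue_measure]_(t in `[a n, N]) (t `^ (- beta))%:E =
    (F N)%:E - (F (a n))%:E)%E.
  apply: continuous_FTC2 => //.
  - apply: continuous_in_subspaceT => t; rewrite inE/= in_itv/= => /andP[at1 _].
    have t0 := lt_le_trans (a0 n) at1.
    apply: differentiable_continuous; apply/derivable1_diffP.
    by have [] := is_derive1_powR (- beta) t0.
  - split.
    + move=> t; rewrite in_itv/= => /andP[at1 _].
      by have [] := dF t (lt_trans (a0 n) at1).
    + exact/cvg_at_right_filter/cF.
    + exact/cvg_at_left_filter/cF.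
  - move=> t; rewrite in_itv/= => /andP[at1 _]; rewrite derive1E.
    by have [] := dF t (lt_trans (a0 n) at1).
have itvE : \bigcup_n `[a n, N]%classic = `]0, N]%classic.
  apply/seteqP; split=> [t [n _] /=|t /=]; rewrite !in_itv/= => /andP[at1 tN].
    by rewrite (lt_le_trans (a0 n)).
  exists (Num.truncn (N / t)) => //=; rewrite in_itv/=; rewrite tN andbT.
  rewrite ler_pdivrMr// mulrC -ler_pdivrMr//.
  by apply/ltW/(lt_le_trans (truncnS_gt _)); rewrite ler_nat.
have cvg_int : (\int[lebesgue_measure]_(t in `[a n, N]) (t `^ (- beta))%:E)%E
    @[n --> \oo] --> (\int[lebesgue_measure]_(t in `]0%R, N]) (t `^ (- beta))%:E)%E.
  rewrite -itvE; apply: ge0_nondecreasing_set_cvg_integral => //.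
  - apply/nondecreasing_seqP => n; apply/subsetPset => t /=; rewrite !in_itv/=.
    move=> /andP[at1 ->]; rewrite andbT (le_trans _ at1)// ler_pM2l//.
    by rewrite lef_pV2 ?posrE// ler_nat.
  - move=> n; apply/measurable_EFinP; apply: measurable_funTS.
    exact: measurable_powR.
  - by move=> n t _; rewrite lee_fin powR_ge0.
rewrite [ltLHS](_ : _ = \int[lebesgue_measure]_(t in `]0%R, N]) (t `^ (- beta))%:E)%E; last first.
  apply: eq_integral => t _; by rewrite /= ger0_norm// powR_ge0.
rewrite -(cvg_lim _ cvg_int)//; apply: (@le_lt_trans _ _ (F N)%:E); last exact: ltry.
apply: lime_le; first exact: cvgP cvg_int.
apply: nearW => n; rewrite intF -EFinB lee_fin gerBl.
by rewrite mulr_ge0 ?powR_ge0// invr_ge0 subr_ge0 ltW.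
Qed.

(** Fractional integral of order [1 - beta], without its Gamma factor, cut off at distance [N]. The
    singularity of the kernel sits at the fixed point [t = 0], so that differentiation in [x] falls
    on [f] alone. *)
Definition weyl f x : R :=
  \int[lebesgue_measure]_(t in `]0, N]) (f (x + s * t) / t `^ beta).

Let isom_continuous f x : continuous f -> continuous (fun t => f (x + s * t)).
Proof.
move=> cf t; apply: continuous_comp; last exact: cf.
by apply: cvgD; [exact: cvg_cst|apply: cvgM; [exact: cvg_cst|exact: cvg_id]].
Qed.

Lemma weyl_integrable f x : continuous f ->
  lebesgue_measure.-integrable `]0, N]
    (EFin \o (fun t : R => f (x + s * t) / t `^ beta)).
Proof.
move=> /(@isom_continuous _ x) cf; have [B [B0 fB]] := continuous_segment_bound N cf.
have mf : measurable_fun setT (fun t => f (x + s * t)).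
  exact: continuous_measurable_fun.
apply: integrableMr integrable_powR_inv => //.
  exact: measurable_funTS.
exists B; split; first exact: num_real.
move=> C BC t; rewrite /= in_itv/= => /andP[t0 tN].
by rewrite (le_trans (fB t _) (ltW BC))// ger0_norm// ltW.
Qed.

Lemma weyl_linear (k : R) f g x : continuous f -> continuous g ->
  weyl (fun y => k * f y + g y) x = k * weyl f x + weyl g x.
Proof.
move=> cf cg; rewrite /weyl -RintegralZl//; last exact: weyl_integrable.
rewrite -RintegralD//; last 2 first.
- by apply: integrableZ_EFin => //; exact: weyl_integrable.
- exact: weyl_integrable.
by apply: eq_Rintegral => t _; rewrite mulrDl mulrA.
Qed.

Lemma weyl_bound : exists2 W : R, 0 < W &
  forall f x (e : R), continuous f -> (forall y, `|f y| <= e) ->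
    `|weyl f x| <= e * W.
Proof.
pose W : R := \int[lebesgue_measure]_(t in `]0, N]) (t `^ beta)^-1.
(* The summand 1 makes the constant positive when the integral is only known to be nonnegative. *)
exists (W + 1); first by rewrite ltr_wpDl// Rintegral_ge0// => t _; rewrite invr_ge0 powR_ge0.
move=> f x e cf fe; have e0 : 0 <= e by exact: le_trans (fe 0).
apply: (@le_trans _ _ (e * W)); last by rewrite ler_wpM2l// lerDl.
rewrite (le_trans (le_normr_Rintegral _ _))//; first exact: weyl_integrable.
rewrite /W -RintegralZl//; last exact: integrable_powR_inv.
apply: le_Rintegral => //.
- exact/integrable_norm/weyl_integrable.
- by apply: integrableZ_EFin => //; exact: integrable_powR_inv.
- move=> t _; have w0 : 0 <= (t `^ beta)^-1 by rewrite invr_ge0 powR_ge0.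
  by rewrite normrM (ger0_norm w0) ler_wpM2r.
Qed.

Let derivable_isom f y x : derivable f (x + s * y) 1 ->
  derivable (fun z => f (z + s * y) / y `^ beta) x 1 /\
  derive1 (fun z => f (z + s * y) / y `^ beta) x = derive1 f (x + s * y) / y `^ beta.
Proof.
have fE : (fun z => f (z + s * y)) = (fun z => f (1 * z + s * y)).
  by apply/funext => z; rewrite mul1r.
move=> df; have df1 : derivable f (1 * x + s * y) 1 by rewrite mul1r.
have dg := derivable_affine df1; have eg := derive1_affine df1.
rewrite -fE in dg eg; rewrite !mul1r in eg; split.
  exact: (derivableM dg (derivable_cst (y `^ beta)^-1 x 1)).
by rewrite [LHS](derive1Mr _ dg) eg.
Qed.

(** Differentiation under the integral sign, dominated by a multiple of the integrable kernel. *)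
Lemma weyl_derive f x : smooth f ->
  derivable (weyl f) x 1 /\ derive1 (weyl f) x = weyl (derive1 f) x.
Proof.
move=> sf; have df y : derivable f y 1 by exact: smooth_derivable.
(* The points [z + s * t] with [z] within 1 of [x] and [0 < t <= N] have absolute value at most
   [|x| + 1 + N]. *)
have [B [B0 f'B]] := continuous_segment_bound (`|x| + 1 + N)
  (smooth_continuous (smooth_derive1 sf)).
pose I : set R := `]x - 1, x + 1[.
have Ix : I x by rewrite /I/= in_itv/=; apply/andP; split; lra.
pose F z t := f (z + s * t) / t `^ beta.
have intF z : I z -> lebesgue_measure.-integrable `]0, N] (EFin \o F z).
  by move=> _; exact/weyl_integrable/smooth_continuous.
have dF z t : I z -> `]0, N]%classic t -> derivable (F ^~ t) z 1.
  by move=> _ _; have [] := derivable_isom (df (z + s * t)).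
pose G t : R := B * (t `^ beta)^-1.
have G0 t : 0 <= G t by rewrite mulr_ge0 ?invr_ge0 ?powR_ge0// ltW.
have intG : lebesgue_measure.-integrable `]0, N] (EFin \o G).
  by apply: integrableZ_EFin => //; exact: integrable_powR_inv.
have d1FE z t : partial1of2 F z t = derive1 f (z + s * t) / t `^ beta.
  by have [_] := derivable_isom (df (z + s * t)).
have ubF z t : I z -> `]0, N]%classic t -> `|partial1of2 F z t| <= G t.
  move=> Iz Nt; rewrite d1FE normrM [X in _ * X]ger0_norm ?invr_ge0 ?powR_ge0//.
  rewrite ler_wpM2r ?invr_ge0 ?powR_ge0// f'B//.
  have s1 : `|s| = 1.
    by apply/eqP; rewrite -(@eqrXn2 _ 2)// real_normK ?num_real// s2 expr1n.
  rewrite (le_trans (ler_normD _ _))// lerD//.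
    move: Iz; rewrite /I/= in_itv/= -ltr_distlC => xz1.
    rewrite -[z](subrK x) addrC (le_trans (ler_normD _ _))// lerD2l.
    by rewrite distrC ltW.
  move: Nt; rewrite /= in_itv/= => /andP[t0 tN].
  by rewrite normrM s1 mul1r ger0_norm// ltW.
split.
  exact: (derivable_under_integral _ Ix intF dF G0 intG ubF).
rewrite [LHS](differentiation_under_integral _ Ix intF dF G0 intG ubF)//.
by apply: eq_Rintegral => t _; rewrite d1FE.
Qed.

Lemma derive1n_weyl f n : smooth f -> derive1n n (weyl f) = weyl (derive1n n f).
Proof.
move=> sf; elim: n => [|n ih]; first exact: erefl.
rewrite derive1nS ih; apply/funext => x.
by have [_ ->] := @weyl_derive _ x (@smooth_derive1n _ _ n sf).
Qed.

Lemma smooth_weyl f : smooth f -> smooth (weyl f).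
Proof.
move=> sf; apply/smoothP => n x; rewrite (derive1n_weyl n sf).
by have [] := @weyl_derive _ x (@smooth_derive1n _ _ n sf).
Qed.

(** Substitution [y = x + s * t], which preserves Lebesgue measure. Since [s ^+ 2 = 1], its inverse
    is [y |-> s * (y - x)], which is why the domain and the kernel are written with this expression
    for both signs. *)
Lemma weyl_change_of_variable f x : continuous f ->
  \int[lebesgue_measure]_(y in (fun y => s * (y - x)) @^-1` `]0, N])
    (f y / (s * (y - x)) `^ beta) = weyl f x.
Proof.
move=> cf; pose T := (fun t => x + s * t) : measurableTypeR R -> measurableTypeR R.
pose D := (fun y : R => s * (y - x)) @^-1` `]0, N].
have mT : measurable_fun setT T.
  by apply: measurable_funD => //; exact: measurable_funM.
have mS : measurable_fun setT (fun y : R => s * (y - x)).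
  by apply: measurable_funM => //; exact: measurable_funB.
have mD : measurable D by rewrite -[D]setTI; exact: mS.
have ST t : s * (T t - x) = t by rewrite /T addrAC subrr add0r mulrA -expr2 s2 mul1r.
have TD : T @^-1` D = `]0, N]%classic.
  by apply/seteqP; split=> t; rewrite /D /= ST.
have gT t : f (T t) / (s * (T t - x)) `^ beta = f (x + s * t) / t `^ beta.
  by rewrite ST.
pose g y := f y / (s * (y - x)) `^ beta.
have mg : measurable_fun [set: measurableTypeR R] (EFin \o g).
  apply/measurable_EFinP; apply: measurable_funM.
    exact: continuous_measurable_fun.
  rewrite (_ : (fun y => _) = (@powR R ^~ (- beta)) \o (fun y => s * (y - x))).
    by apply: measurableT_comp mS; exact: measurable_powR.
  by apply/funext => y /=; rewrite powRN.
have ig : lebesgue_measure.-integrable (T @^-1` D) ((EFin \o g) \o T).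
  rewrite TD; apply: eq_integrable (@weyl_integrable _ x cf) => //.
  by move=> t _ /=; rewrite /g gT.
have pushE := integral_pushforward mT mg ig mD.
have isoE : (\int[lebesgue_measure]_(y in D) (EFin \o g) y =
    \int[pushforward lebesgue_measure T]_(y in D) (EFin \o g) y)%E.
  by apply: eq_measure_integral => A mA _; exact/esym/lebesgue_measure_isometry.
rewrite [LHS]/Rintegral [X in fine X](etrans isoE pushE) TD.
apply: (congr1 fine); apply: eq_integral => t _; exact: congr1 (gT t).
Qed.

End weyl_integral.

(** * Supports and test functions *)

Section test_functions.
Context {R : realType}.
Implicit Types (Omega : domain R) (f g phi chi psi : R -> R).

Lemma fsupp_eq0 f x : ~ fsupp f x -> f x = 0.
Proof.
by move=> nfx; apply/eqP; apply: contra_notT nfx => fx; exact: subset_closure.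
Qed.

Lemma fsupp_sub f (C : set R) : closed C -> (forall x, ~ C x -> f x = 0) ->
  fsupp f `<=` C.
Proof.
move=> cC fC; rewrite (closure_id C).1//; apply: closure_subset => x /= fx.
by apply: contrapT => /fC fx0; rewrite fx0 eqxx in fx.
Qed.

Lemma fsupp_mono f g : (forall x, g x = 0 -> f x = 0) -> fsupp f `<=` fsupp g.
Proof.
move=> fg; apply: fsupp_sub; first exact: closed_closure.
by move=> x /fsupp_eq0/fg.
Qed.

Lemma testfun_smooth Omega phi : testfun Omega phi -> smooth phi.
Proof. by case. Qed.

Lemma testfun_mono Omega phi f : testfun Omega phi -> smooth f ->
  (forall x, phi x = 0 -> f x = 0) -> testfun Omega f.
Proof.
move=> [_ cphi phiO] sf fphi; have ffphi := fsupp_mono fphi; split=> //.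
  by apply: subclosed_compact cphi ffphi; exact: closed_closure.
exact: subset_trans phiO.
Qed.

Lemma testfunM Omega phi f : testfun Omega phi -> smooth f ->
  testfun Omega (phi \* f).
Proof.
move=> tphi sf; apply: (testfun_mono tphi).
  exact: (smoothM (testfun_smooth tphi) sf).
by move=> x /= ->; rewrite mul0r.
Qed.

Lemma testfun_lin Omega phi chi (k : R) : testfun Omega phi ->
  testfun Omega chi -> testfun Omega (fun x => k * phi x + chi x).
Proof.
move=> [sphi cphi phiO] [schi cchi chiO].
have sub : fsupp (fun x => k * phi x + chi x) `<=` fsupp phi `|` fsupp chi.
  apply: fsupp_sub; first by apply: closedU; exact: closed_closure.
  by move=> x /not_orP[/fsupp_eq0 -> /fsupp_eq0 ->]; rewrite mulr0 addr0.
split; first exact: (smoothD (smoothZ (k := k) sphi) schi).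
- apply: (subclosed_compact _ (compactU cphi cchi) sub); exact: closed_closure.
- by move=> x /sub[/phiO|/chiO].
Qed.

Lemma compact_bound (C : set R) : compact C ->
  exists2 M : R, 0 < M & forall x, M <= `|x| -> ~ C x.
Proof.
move=> /compact_bounded[B [_ hB]]; exists (`|B| + 2); first by rewrite ltr_wpDl.
move=> x Bx Cx; have : `|x| <= `|B| + 1.
  by apply: hB => //; rewrite (le_lt_trans (ler_norm B))// ltrDl.
by lra.
Qed.

Lemma testfun_bound Omega phi : testfun Omega phi ->
  exists2 M : R, 0 < M & forall x, M <= `|x| -> phi x = 0.
Proof.
move=> [_ /compact_bound[M M0 hM] _]; exists M => // x /hM; exact: fsupp_eq0.
Qed.

(** A nonzero test function already at hand serves as the bump, so no explicit one has to be
    constructed. *)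
Lemma smooth_step Omega phi (p q : R) : testfun Omega phi ->
  (exists x, phi x != 0) -> p < q ->
  exists H : R -> R, [/\ smooth H, forall x, x <= p -> H x = 0
                      & forall x, q <= x -> H x = 1].
Proof.
move=> tphi [x0 phix0] pq; have [M M0 phiM] := testfun_bound tphi.
have [H [sH H0 H1]] := smooth_step_of_bump (testfun_smooth tphi) phiM phix0.
have pq0 : 0 < q - p by rewrite subr_gt0.
(* The affine map of slope [l] that sends the midpoint of [[p, q]] to 0 carries [[p, q]] onto
   [[- M, M]], where the step [H] makes its transition. *)
pose l := 2 * M / (q - p); have l0 : 0 < l by rewrite divr_gt0// mulr_gt0.
have lpq : l * (q - p) = 2 * M by rewrite /l divfK// gt_eqF.
exists (fun x => H (l * x + - (l * ((p + q) / 2)))); split.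
- exact: smooth_affine.
- by move=> x xp; apply: H0; nra.
- by move=> x qx; apply: H1; nra.
Qed.

End test_functions.

(** * A distribution that vanishes locally on a support vanishes there globally *)

Section vanishing.
Context {R : realType}.
Variables (Omega : domain R) (u : (R -> R) -> R).
Hypothesis hu : is_distribution Omega u.
Implicit Types (phi chi psi : R -> R).

Lemma distributionD phi chi : testfun Omega phi -> testfun Omega chi ->
  u (phi \+ chi) = u phi + u chi.
Proof.
move=> tphi tchi; rewrite -[u phi]mul1r -hu.1//; congr u.
by apply/funext => x /=; rewrite mul1r.
Qed.

Lemma distribution0 phi : testfun Omega phi -> (forall x, phi x = 0) -> u phi = 0.
Proof.
move=> tphi phi0; apply: (@addrI _ (u phi)); rewrite -distributionD// addr0.
by congr u; apply/funext => x /=; rewrite phi0 addr0.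
Qed.

(* Induction along the real line: the supremum of the [t] such that [u] kills
   every test function vanishing where [phi] does and beyond [t] can be pushed
   further to the right by splitting with a smooth step. *)
Lemma locally_vanishing phi : testfun Omega phi ->
  (forall x, fsupp phi x -> exists V : set R,
     [/\ open V, V x & vanishes_on Omega u V]) ->
  u phi = 0.
Proof.
move=> tphi hV.
have [[x0 phix0]|/forallNP phi0] := pselect (exists x, phi x != 0); last first.
  by apply: distribution0 => // x; apply/eqP/negPn/negP; exact: phi0.
have [M M0 phiM] := testfun_bound tphi.
pose S : set R := [set t | forall chi, testfun Omega chi ->
  (forall x, phi x = 0 -> chi x = 0) -> (forall x, t < x -> chi x = 0) ->
  u chi = 0].
have SM : S M -> u phi = 0.
  by apply => // x Mx; apply: phiM; rewrite (le_trans (ltW Mx))// ler_norm.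
have Sle t t' : S t -> t' <= t -> S t'.
  move=> St tt' chi tchi sub chi0; apply: St => // x tx.
  by apply: chi0; exact: le_lt_trans tx.
apply: contrapT => /(contra_not SM) NSM.
(* [S] is closed downwards, so if it misses [M] then [M] bounds it from above. *)
have ubS : ubound S M.
  by move=> t St; rewrite leNgt; apply/negP => /ltW Mt; apply: NSM; exact: Sle Mt.
have S0 : S (- M).
  move=> chi tchi sub chi0; apply: distribution0 => // x.
  have [Mx|xM] := ltP (- M) x; first exact: chi0.
  by apply/sub/phiM; rewrite -normrN (le_trans _ (ler_norm _))// lerNr.
have supS : has_sup S by split; [exists (- M)|exists M].
pose t0 := sup S.
(* If [t0] lies in the support of [phi], a small ball around it lies in an open set on which [u]
   vanishes; the radius is halved because supports are closed. Otherwise [phi], and hence [chi], is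
   zero on a ball around [t0]. *)
have [e e0 he] : exists2 e : R, 0 < e & forall chi, testfun Omega chi ->
    (forall x, phi x = 0 -> chi x = 0) -> (forall x, e <= `|t0 - x| -> chi x = 0) ->
    u chi = 0.
  have [/hV[V [oV Vt0 uV]]|nt0] := pselect (fsupp phi t0).
    have [e /= e0 eV] : nbhs_ball t0 V by apply/nbhs_ballP; exact: open_nbhs_nbhs.
    exists (e / 2); first by rewrite divr_gt0.
    move=> chi tchi _ chi0; apply: uV => //.
    apply: (@subset_trans _ (closed_ball t0 (e / 2))); last first.
      exact: subset_trans (subset_closure_half e0) eV.
    apply: fsupp_sub; first exact: closed_ball_closed.
    move=> x nx; apply: chi0; rewrite leNgt; apply/negP => xe; apply: nx.
    by apply: subset_closed_ball; rewrite -ball_normE.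
  have : nbhs_ball t0 (~` fsupp phi).
    apply/nbhs_ballP; apply: open_nbhs_nbhs; split => //.
    exact/closed_openC/closed_closure.
  move=> [e /= e0 eV]; exists e => // chi tchi sub chi0; apply: distribution0 => // x.
  have [ex|xe] := leP e `|t0 - x|; first exact: chi0.
  by apply/sub/fsupp_eq0/eV; rewrite -ball_normE.
have [t1 St1] := sup_adherent (divr_gt0 e0 (ltr0n R 3)) supS.
rewrite -/t0 => t1lt.
suff : S (t0 + e / 2).
  by move=> /(ub_le_sup supS.2); rewrite -/t0; lra.
move=> chi tchi sub chi0.
(* [chi * (1 - H)] vanishes from [t0 - e / 3] on, hence beyond [t1], and is killed since [t1] is in
   [S]. [chi * H] is nonzero only between [t0 - 2 * e / 3] and [t0 + e / 2], within [e] of [t0], and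
   is killed by [he]. *)
have [H [sH H0 H1]] := smooth_step (p := t0 - 2 * e / 3) (q := t0 - e / 3) tphi
  (ex_intro _ x0 phix0) ltac:(lra).
have schi := testfun_smooth tchi.
have tH := testfunM tchi sH.
have s1H : smooth (fun x => 1 - H x) by exact: (smoothB (@smooth_cst R 1) sH).
have t1H := testfunM tchi s1H.
have -> : chi = (chi \* (fun x => 1 - H x)) \+ (chi \* H).
  by apply/funext => x /=; rewrite -mulrDr subrK mulr1.
rewrite distributionD// St1//.
- rewrite add0r; apply: he => // x.
    by move=> /sub /= ->; rewrite mul0r.
  rewrite ler_normr => /orP[ex|ex] /=; last by rewrite chi0 ?mul0r//; lra.
  by rewrite H0 ?mulr0//; lra.
- by move=> x /sub /= ->; rewrite mul0r.
- by move=> x t1x /=; rewrite H1 ?subrr ?mulr0//; lra.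
Qed.

End vanishing.

(** * Continuous operators from test functions to smooth functions *)

Section test_operators.
Context {R : realType}.
Implicit Types (Omega : domain R) (D : (R -> R) -> R -> R) (u : (R -> R) -> R).

(** Sequentially continuous linear maps from the test functions to the smooth functions on the line.
    Convergence in the target is uniform only on bounded sets, for every derivative, because [D phi]
    need not have compact support. *)
Definition test_operator Omega D :=
  [/\ forall (k : R) phi chi, testfun Omega phi -> testfun Omega chi ->
        D (fun x => k * phi x + chi x) = (fun x => k * D phi x + D chi x),
      forall phi, testfun Omega phi -> smooth (D phi)
    & forall (phi_ : nat -> R -> R) phi, (forall k, testfun Omega (phi_ k)) ->
        testfun Omega phi -> testfun_cvg Omega phi_ phi ->
        forall (X : R) n (e : R), 0 < e -> \forall k \near \oo,
          forall x, `|x| <= X ->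
            `|derive1n n (D (phi_ k)) x - derive1n n (D phi) x| < e].

(** Multiplication by [psi] brings [D phi] back to a test function, and the support of [psi] is the
    common compact set required for convergence of test functions. *)
Lemma distribution_comp Omega D u psi (c : R) :
  test_operator Omega D -> is_distribution Omega u -> testfun Omega psi ->
  is_distribution Omega (fun phi => c * u (fun x => psi x * D phi x)).
Proof.
move=> [linD smD cvgD] [linu cvgu] tpsi.
have tD phi : testfun Omega phi -> testfun Omega (fun x => psi x * D phi x).
  by move=> /smD; exact: testfunM.
split=> [k phi chi tphi tchi|phi_ phi tphi_ tphi cphi].
  have -> : (fun x => psi x * D (fun y => k * phi y + chi y) x) =
      (fun x => k * (psi x * D phi x) + psi x * D chi x).
    by apply/funext => x; rewrite linD// mulrDr mulrCA.
  by rewrite linu; [ring|exact: tD|exact: tD].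
apply: cvgMr; apply: cvgu => [k||].
- exact: tD.
- exact: tD.
have [_ cptpsi psiO] := tpsi.
split; first exists (fsupp psi).
  by split=> // k; apply: fsupp_mono => x ->; rewrite mul0r.
have [X X0 psiX] := testfun_bound tpsi.
have sh k : smooth (D (phi_ k) \- D phi) by apply: smoothB; exact: smD.
have spsi := testfun_smooth tpsi.
move=> n; apply/uniform_cvgP => e e0.
have psi0 x : X < `|x| -> psi x = 0 by move=> /ltW; exact: psiX.
have h0 m (d : R) : 0 < d -> \forall k \near \oo, forall x, `|x| <= X ->
    `|derive1n m (D (phi_ k) \- D phi) x| < d.
  move=> d0; have := cvgD _ _ tphi_ tphi cphi X m _ d0.
  apply: filterS => k hk x /hk.
  by rewrite (derive1nB m (smD _ (tphi_ k)) (smD _ tphi)).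
have := derive1n_mul_cvg0 spsi psi0 sh h0 n e0.
apply: filterS => k hk x _; have := hk x.
have -> : psi \* (D (phi_ k) \- D phi) = (psi \* D (phi_ k)) \- (psi \* D phi).
  by apply/funext => y /=; rewrite mulrBr.
by rewrite (derive1nB n (smoothM spsi (smD _ (tphi_ k))) (smoothM spsi (smD _ tphi))).
Qed.

Lemma test_operator_derive1n Omega m : test_operator Omega (derive1n m).
Proof.
split=> [k phi chi tphi tchi|phi tphi|phi_ phi tphi_ tphi [_ cphi] X n e e0].
- have sphi := testfun_smooth tphi; have schi := testfun_smooth tchi.
  have := derive1nD m (smoothZ (k := k) sphi) schi.
  by rewrite (derive1nZ k m sphi).
- exact: (@smooth_derive1n _ _ m (testfun_smooth tphi)).
- have /uniform_cvgP/(_ _ e0) := cphi (n + m)%N.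
  by apply: filterS => k hk x _; have := hk x I; rewrite /derive1n !iterD.
Qed.

(* [I] agrees near every point with a truncated Weyl integral, uniformly for
   test functions with support in a fixed interval. *)
Lemma test_operator_weyl Omega (I : (R -> R) -> R -> R) (beta s c k : R) m :
  beta < 1 -> s ^+ 2 = 1 ->
  (forall M X : R, exists2 N : R, 0 < N & forall phi, testfun Omega phi ->
     (forall x, M <= `|x| -> phi x = 0) ->
     forall x, `|x| < X -> I phi x = c * weyl beta s N phi x) ->
  test_operator Omega (fun phi => k \*o derive1n m (I phi)).
Proof.
move=> beta1 s2 hI.
have oball (X : R) : open [set x : R | `|x| < X].
  rewrite (_ : [set x : R | `|x| < X] = Num.norm @^-1` `]-oo, X[); last first.
    by apply/seteqP; split=> x /=; rewrite in_itv.
  by apply: open_comp; [move=> x _; exact: norm_continuous|exact: interval_open].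
(* The agreement with the Weyl integral holds on the open set [|x| < X], so it passes to all
   derivatives there, and the Weyl integral commutes with them. *)
have derI (M X : R) : exists2 N : R, 0 < N & forall phi, testfun Omega phi ->
    (forall x, M <= `|x| -> phi x = 0) -> forall n x, `|x| < X ->
    derivable (derive1n n (I phi)) x 1 /\
    derive1n n (I phi) x = c * weyl beta s N (derive1n n phi) x.
  have [N N0 hN] := hI M X; exists N => // phi tphi phiM n x xX.
  have sphi := testfun_smooth tphi; have := hN phi tphi phiM => Iphi.
  have sW : smooth (weyl beta s N phi) by exact: smooth_weyl.
  have dI y : `|y| < X -> derive1n n (I phi) y = c * weyl beta s N (derive1n n phi) y.
    move=> yX; have := derive1n_open (g := c \*o weyl beta s N phi) n (oball X) Iphi yX.
    rewrite (derive1nZ c n sW) (derive1n_weyl beta1 s2 N0 n sphi).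
    exact.
  split; last exact: dI.
  apply: (@derivable_open _ _ _ (c \*o weyl beta s N (derive1n n phi)) _ (oball X) dI xX).
  apply: derivableZ; apply: smooth_derivable.
  exact: (smooth_weyl beta1 s2 N0 (@smooth_derive1n _ _ n sphi)).
have smI phi : testfun Omega phi -> smooth (I phi).
  move=> tphi; apply/smoothP => n x; have [M M0 phiM] := testfun_bound tphi.
  have [N N0 hN] := derI M (`|x| + 1).
  by have [] := hN _ tphi phiM n x; rewrite ?ltrDl.
split=> [l phi chi tphi tchi|phi tphi|phi_ phi tphi_ tphi [[C [cC _ subC]] cphi] X n e e0].
- have sphi := testfun_smooth tphi; have schi := testfun_smooth tchi.
  have [M M0 phiM] := testfun_bound tphi; have [L L0 chiL] := testfun_bound tchi.
  (* The larger of the two support bounds gives a single [N] valid for [phi], [chi] and their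
     combination. *)
  apply/funext => x; have [N N0 hN] := derI (Num.max M L) (`|x| + 1).
  have xx1 : `|x| < `|x| + 1 by rewrite ltrDl.
  have phiML y : Num.max M L <= `|y| -> phi y = 0 by rewrite ge_max => /andP[/phiM].
  have chiML y : Num.max M L <= `|y| -> chi y = 0 by rewrite ge_max => /andP[_ /chiL].
  have tlin := testfun_lin l tphi tchi.
  have linML y : Num.max M L <= `|y| -> l * phi y + chi y = 0.
    by move=> yM; rewrite phiML// chiML// mulr0 addr0.
  rewrite /=; have [_ ->] := hN _ tlin linML m x xx1.
  have [_ ->] := hN _ tphi phiML m x xx1.
  have [_ ->] := hN _ tchi chiML m x xx1.
  have := derive1nD m (smoothZ (k := l) sphi) schi.
  rewrite (derive1nZ l m sphi) => ->.
  rewrite (weyl_linear s beta1 N0)/=; last 2 first.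
    exact: (smooth_continuous (@smooth_derive1n _ _ m sphi)).
    exact: (smooth_continuous (@smooth_derive1n _ _ m schi)).
  by ring.
- exact: (smoothZ (@smooth_derive1n _ _ m (smI _ tphi))).
- have [M M0 phiM] := testfun_bound tphi; have [L L0 CL] := compact_bound cC.
  have [N N0 hN] := derI (Num.max M L) (X + 1).
  have phiML y : Num.max M L <= `|y| -> phi y = 0 by rewrite ge_max => /andP[/phiM].
  have phi_ML j y : Num.max M L <= `|y| -> phi_ j y = 0.
    rewrite ge_max => /andP[_ /CL nC]; apply: fsupp_eq0 => /subC; exact: nC.
  have [W W0 hW] := weyl_bound s beta1 N0.
  (* Chosen so that [|k * c| * (d * W) < e]; the added 1 covers the case [k * c = 0]. *)
  pose d := e / (`|k * c| + 1) / W.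
  have kc0 : 0 < `|k * c| + 1 by rewrite ltr_wpDl.
  have d0 : 0 < d by rewrite !divr_gt0.
  have /uniform_cvgP/(_ _ d0) := cphi (n + m)%N.
  apply: filterS => j hj x xX; have xX1 : `|x| < X + 1 by rewrite (le_lt_trans xX)// ltrDl.
  have sI chi : testfun Omega chi -> (forall y, Num.max M L <= `|y| -> chi y = 0) ->
      derive1n n (k \*o derive1n m (I chi)) x = k * (c * weyl beta s N (derive1n (n + m) chi) x).
    move=> tchi chiM; rewrite (derive1nZ k n (@smooth_derive1n _ _ m (smI _ tchi))).
    have [_] := hN _ tchi chiM (n + m)%N x xX1; rewrite /derive1n iterD => <-.
    exact: erefl.
  rewrite (sI _ (tphi_ j) (phi_ML j)) (sI _ tphi phiML).
  have sphi := @smooth_derive1n _ _ (n + m) (testfun_smooth tphi).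
  have sphij := @smooth_derive1n _ _ (n + m) (testfun_smooth (tphi_ j)).
  (* Linearity with coefficient -1 writes the difference of two Weyl integrals as the Weyl integral
     [A] of a difference, to which the sup norm bound applies. *)
  have := weyl_linear s beta1 N0 (-1) x (smooth_continuous sphi) (smooth_continuous sphij).
  set A := weyl _ _ _ _ x; set B := weyl _ _ _ (derive1n _ phi) x; set B' := weyl _ _ _ (derive1n _ (phi_ j)) x.
  move=> AE.
  have -> : k * (c * B') - k * (c * B) = (k * c) * A by rewrite AE; ring.
  have Ad : `|A| <= d * W.
    apply: hW => [|y].
      exact: (smooth_continuous (smoothD (smoothZ (k := -1) sphi) sphij)).
    by have := hj y; rewrite mulN1r addrC => /(_ Logic.I)/ltW.
  rewrite normrM (le_lt_trans (ler_wpM2l (normr_ge0 _) Ad))// /d divfK ?gt_eqF//.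
  by rewrite mulrCA -[ltRHS]mulr1 ltr_pM2l// ltr_pdivrMr// mul1r ltrDl.
Qed.

End test_operators.

(** * One-sided fractional derivatives: continuity and propagation of supports *)

Section fractional_derivatives.
Context {R : realType}.
Implicit Types (Omega : domain R) (phi : R -> R).

Lemma eq_Rintegral_trim (A B : set R) (g : R -> R) :
  (forall y, A y -> ~ B y -> g y = 0) -> (forall y, B y -> ~ A y -> g y = 0) ->
  \int[lebesgue_measure]_(y in A) g y = \int[lebesgue_measure]_(y in B) g y.
Proof.
move=> AB BA; rewrite Rintegral_mkcond [RHS]Rintegral_mkcond.
congr Rintegral; apply/funext => y; rewrite /patch.
case: ifPn => [/set_mem Ay|]; case: ifPn => [/set_mem By|] //; rewrite notin_setE.
  exact: AB.
by move=> /(BA _ By).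
Qed.

Lemma Rintegral_eq0 (A : set R) (g : R -> R) : (forall y, A y -> g y = 0) ->
  \int[lebesgue_measure]_(y in A) g y = 0.
Proof. by move=> g0; rewrite /Rintegral integral0_eq// => y /g0 ->. Qed.

(** Treats both sides at once, through the sign [s]. The range [rng x] and the truncated range
    differ only at points where [phi] vanishes: those outside [Omega], and those farther than [N]
    from [x]. *)
Lemma range_weyl Omega (rng : R -> set R) (beta s : R) :
  beta < 1 -> s ^+ 2 = 1 ->
  (forall x y, rng x y -> 0 < s * (y - x)) ->
  (forall x y, dom_set Omega y -> 0 < s * (y - x) -> rng x y) ->
  forall M X : R, exists2 N : R, 0 < N & forall phi, testfun Omega phi ->
    (forall x, M <= `|x| -> phi x = 0) -> forall x, `|x| < X ->
    \int[lebesgue_measure]_(y in rng x) (phi y / (s * (y - x)) `^ beta) =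
    weyl beta s N phi x.
Proof.
move=> beta1 s2 rng0 rngO M X.
(* If [|y - x|] exceeds this [N] and [|x| < X], then [|y| >= M], so [phi y = 0]. *)
have N0 : 0 < `|M| + `|X| + 1 by rewrite ltr_wpDl// addr_ge0.
exists (`|M| + `|X| + 1); first exact: N0.
move=> phi tphi phiM x xX.
have cphi := smooth_continuous (testfun_smooth tphi).
rewrite -(weyl_change_of_variable beta1 s2 N0 x cphi).
apply: eq_Rintegral_trim => y /=; rewrite in_itv/=.
- move=> /rng0 -> /negP /=; rewrite -ltNge => Nxy; rewrite phiM ?mul0r//.
  have s1 : `|s| = 1.
    by apply/eqP; rewrite -(@eqrXn2 _ 2)// real_normK ?num_real// s2 expr1n.
  have := le_trans (ltW Nxy) (ler_norm _); rewrite normrM s1 mul1r.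
  have := ler_normB y x; have := ler_norm M; have := ler_norm X; lra.
- move=> /andP[xy _] nrng; have [_ _ phiO] := tphi.
  rewrite (@fsupp_eq0 _ phi y) ?mul0r// => /phiO Oy.
  by apply: nrng; exact: rngO.
Qed.

Lemma right_int_weyl Omega (sigma : R) : 0 < sigma ->
  forall M X : R, exists2 N : R, 0 < N & forall phi, testfun Omega phi ->
    (forall x, M <= `|x| -> phi x = 0) -> forall x, `|x| < X ->
    right_int Omega sigma phi x = (Gamma sigma)^-1 * weyl (1 - sigma) 1 N phi x.
Proof.
move=> sigma0 M X.
have [| |x y|x y|N N0 hN] := @range_weyl Omega (right_range Omega) (1 - sigma) 1 _ _ _ _ M X.
- by rewrite gtrBl.
- by rewrite expr1n.
- by rewrite mul1r subr_gt0; case: Omega => [a b ab|] /=; rewrite in_itv/= => /andP[].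
- rewrite mul1r subr_gt0; case: Omega => [a b ab|] /=; rewrite !in_itv/=.
    by move=> /andP[_ ->] ->.
  by move=> _ ->.
exists N; first exact: N0.
move=> phi tphi phiM x xX; rewrite /right_int -(hN phi tphi phiM x xX).
apply: (congr1 (fun z => _ * z)); apply: eq_Rintegral => y _.
by rewrite mul1r.
Qed.

Lemma left_int_weyl Omega (sigma : R) : 0 < sigma ->
  forall M X : R, exists2 N : R, 0 < N & forall phi, testfun Omega phi ->
    (forall x, M <= `|x| -> phi x = 0) -> forall x, `|x| < X ->
    left_int Omega sigma phi x = (Gamma sigma)^-1 * weyl (1 - sigma) (-1) N phi x.
Proof.
move=> sigma0 M X.
have [| |x y|x y|N N0 hN] := @range_weyl Omega (left_range Omega) (1 - sigma) (-1) _ _ _ _ M X.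
- by rewrite gtrBl.
- by rewrite sqrrN expr1n.
- rewrite mulN1r opprB subr_gt0.
  by case: Omega => [a b ab|] /=; rewrite in_itv/= => // /andP[].
- rewrite mulN1r opprB subr_gt0; case: Omega => [a b ab|] /=; rewrite !in_itv/=.
    by move=> /andP[-> _] ->.
  by move=> _ ->.
exists N; first exact: N0.
move=> phi tphi phiM x xX; rewrite /left_int -(hN phi tphi phiM x xX).
apply: (congr1 (fun z => _ * z)); apply: eq_Rintegral => y _.
by rewrite mulN1r opprB.
Qed.

Lemma test_operator_right_der Omega (alpha : R) : 0 < alpha ->
  test_operator Omega (right_der Omega alpha).
Proof.
move=> alpha0; have [aN|/negbTE aN] := boolP (alpha \is a Num.nat).
  have -> : right_der Omega alpha = derive1n (Num.truncn alpha).
    by apply/funext => phi; rewrite /right_der aN.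
  exact: test_operator_derive1n.
set n := (Num.truncn alpha).+1.
have -> : right_der Omega alpha =
    (fun phi => (-1) ^+ n \*o derive1n n (right_int Omega (n%:R - alpha) phi)).
  by apply/funext => phi; rewrite /right_der aN.
have n0 : 0 < n%:R - alpha by rewrite subr_gt0 truncnS_gt.
have beta1 : 1 - (n%:R - alpha) < 1 by rewrite gtrBl.
have s2 : 1 ^+ 2 = 1 :> R by rewrite expr1n.
apply: (test_operator_weyl _ _ beta1 s2 (right_int_weyl Omega n0)).
Qed.

Lemma test_operator_left_der Omega (alpha : R) : 0 < alpha ->
  test_operator Omega (left_der Omega alpha).
Proof.
move=> alpha0; have [aN|/negbTE aN] := boolP (alpha \is a Num.nat).
  have -> : left_der Omega alpha = derive1n (Num.truncn alpha).
    by apply/funext => phi; rewrite /left_der aN.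
  exact: test_operator_derive1n.
set n := (Num.truncn alpha).+1.
have -> : left_der Omega alpha =
    (fun phi => 1 \*o derive1n n (left_int Omega (n%:R - alpha) phi)).
  apply/funext => phi; rewrite /left_der aN.
  by apply/funext => x /=; rewrite mul1r.
have n0 : 0 < n%:R - alpha by rewrite subr_gt0 truncnS_gt.
have beta1 : 1 - (n%:R - alpha) < 1 by rewrite gtrBl.
have s2 : (-1) ^+ 2 = 1 :> R by rewrite sqrrN expr1n.
apply: (test_operator_weyl _ _ beta1 s2 (left_int_weyl Omega n0)).
Qed.

(** The right integral at [x] samples [phi] only to the right of [x], so it vanishes on the whole
    open half-line beyond [c], and so do its derivatives. *)
Lemma right_der_eq0 Omega (alpha c : R) phi : (forall x, c < x -> phi x = 0) ->
  forall x, c < x -> right_der Omega alpha phi x = 0.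
Proof.
move=> phi0; have oc : open [set x : R | c < x].
  by rewrite (_ : [set x | c < x] = `]c, +oo[%classic) ?set_itvoy//; exact: interval_open.
have int0 sigma y : c < y -> right_int Omega sigma phi y = 0.
  move=> cy; rewrite /right_int Rintegral_eq0 ?mulr0// => z yz.
  rewrite phi0 ?mul0r//; apply: lt_trans cy _; move: yz.
  by case: Omega => [a b ab|] /=; rewrite in_itv/= => /andP[].
rewrite /right_der; case: ifPn => _ x cx; first exact: (derive1n_eq0 _ oc phi0 cx).
exact: etrans (congr1 (fun z => _ * z) (derive1n_eq0 _ oc (int0 _) cx)) (mulr0 _).
Qed.

Lemma left_der_eq0 Omega (alpha c : R) phi : (forall x, x < c -> phi x = 0) ->
  forall x, x < c -> left_der Omega alpha phi x = 0.
Proof.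
move=> phi0; have oc : open [set x : R | x < c].
  by rewrite (_ : [set x | x < c] = `]-oo, c[%classic) ?set_itvNyo//; exact: interval_open.
have int0 sigma y : y < c -> left_int Omega sigma phi y = 0.
  move=> cy; rewrite /left_int Rintegral_eq0 ?mulr0// => z yz.
  rewrite phi0 ?mul0r//; apply: lt_trans cy; move: yz.
  by case: Omega => [a b ab|] /=; rewrite in_itv/= => // /andP[].
rewrite /left_der; case: ifPn => _ x cx; first exact: (derive1n_eq0 _ oc phi0 cx).
exact: (derive1n_eq0 _ oc (int0 _) cx).
Qed.

(** Leaves a gap between the support of a test function and the end of an open half-line containing
    it; a closed half-line disjoint from [K] fits there. The maximum of [C] serves as [c'], and any
    smaller number than [c] does when [C] is empty. *)
Lemma compact_lt (C : set R) (c : R) : compact C -> C `<=` `]-oo, c[ ->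
  exists2 c' : R, c' < c & forall x, C x -> x <= c'.
Proof.
move=> cC Cc; have [[x0 Cx0]|C0] := pselect (C !=set0); last first.
  exists (c - 1); first by rewrite gtrBl.
  by move=> x Cx; exfalso; apply: C0; exists x.
have [||x /set_mem Cx hx] := @compact_EVT_max _ _ id C _ cC _.
- by exists x0.
- by apply: continuous_subspaceT => y; exact: cvg_id.
by exists x; [have := Cc x Cx; rewrite /= in_itv|move=> y /mem_set/hx].
Qed.

Lemma compact_gt (C : set R) (c : R) : compact C -> C `<=` `]c, +oo[ ->
  exists2 c' : R, c < c' & forall x, C x -> c' <= x.
Proof.
move=> cC Cc; have [||c' cc' hc'] := @compact_lt (-%R @` C) (- c).
- apply: continuous_compact => //; apply: continuous_subspaceT => y.
  exact: opp_continuous.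
- move=> _ [x /Cc /= + <-]; rewrite !in_itv/= andbT; lra.
exists (- c'); first by rewrite ltrNr.
by move=> x Cx; rewrite lerNl; apply: hc'; exists x.
Qed.

(** For [phi] supported in [V], the function [psi * D phi] is supported in the closed set [C], which
    misses [K] and hence the support of [u]. Every point of its support therefore has a
    neighbourhood on which [u] vanishes, and [locally_vanishing] concludes. *)
Lemma dsupp_weak_der Omega K (u : (R -> R) -> R) psi D (V : set R) (k : R) :
  is_distribution_on Omega K u -> testfun Omega psi -> test_operator Omega D ->
  open V ->
  (forall phi, testfun Omega phi -> fsupp phi `<=` V ->
    exists C : set R, [/\ closed C, C `&` K = set0
                        & forall x, ~ C x -> D phi x = 0]) ->
  dsupp Omega (fun phi => k * u (fun x => psi x * D phi x)) `<=`
    ~` V `&` dom_set Omega.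
Proof.
move=> [hu uK] tpsi [_ smD _] oV hV x [Ox nx]; split => //.
move=> Vx; apply: nx; exists V => //; split=> // phi tphi phiV.
have [C [cC CK C0]] := hV phi tphi phiV.
rewrite (locally_vanishing hu) ?mulr0//; first exact: testfunM (smD _ tphi).
move=> y Fy; have [_ _ psiO] := tpsi.
have Cy : C y.
  by apply: fsupp_sub Fy => // z /C0 ->; rewrite mulr0.
have Oy : dom_set Omega y.
  by apply: psiO; apply: fsupp_mono Fy => z ->; rewrite mul0r.
apply: contrapT => nV; have : K y.
  apply: uK; split=> // -[W [oW uW] Wy]; apply: nV; exists W; split => //.
by move=> Ky; have : (C `&` K) y by []; rewrite CK.
Qed.

End fractional_derivatives.

(** * Continuity, supports and convergence of the weak derivatives *)

Theorem theorem6p2 (R : realType) (Omega : domain R) (alpha : R) (K : set R)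
    (u : (R -> R) -> R) (psi : R -> R)
    (halpha : 0 < alpha) (hKc : compact K) (hKOmega : K `<=` dom_set Omega)
    (hu : is_distribution_on Omega K u) (hpsi : cutoff Omega K psi) :
  ((is_distribution Omega (left_weak_der Omega psi alpha u) /\
    is_distribution Omega (right_weak_der Omega psi alpha u)) /\
   (forall c d : R, c <= d -> K `<=` `[c, d] -> `[c, d] `<=` dom_set Omega ->
      dsupp Omega (left_weak_der Omega psi alpha u)
        `<=` `[c, +oo[ `&` dom_set Omega /\
      dsupp Omega (right_weak_der Omega psi alpha u)
        `<=` `]-oo, d] `&` dom_set Omega))
  /\
  (forall u_ : nat -> (R -> R) -> R,
     (forall j, is_distribution_on Omega K (u_ j)) ->
     distribution_cvg Omega u_ u ->
     distribution_cvg Omega (fun j => left_weak_der Omega psi alpha (u_ j))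
       (left_weak_der Omega psi alpha u) /\
     distribution_cvg Omega (fun j => right_weak_der Omega psi alpha (u_ j))
       (right_weak_der Omega psi alpha u)).
Proof.
have [tpsi _] := hpsi.
have opR := test_operator_right_der Omega halpha.
have opL := test_operator_left_der Omega halpha.
split; first split; first split.
- exact: (distribution_comp _ opR hu.1 tpsi).
- exact: (distribution_comp _ opL hu.1 tpsi).
- move=> c d cd Kcd _; split.
  + have sub : ~` `]-oo, c[ `<=` `[c, +oo[%classic.
      by move=> x /= /negP; rewrite !in_itv/= -leNgt andbT.
    apply: (@subset_trans _ (~` `]-oo, c[ `&` dom_set Omega)); last first.
      by move=> x [/sub cx Ox].
    apply: (dsupp_weak_der hu tpsi opR) => [|phi tphi phic].
      exact: interval_open.
    (* The compact support of [phi] ends at or before some [c' < c]. The right derivative vanishes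
       beyond [c'], so all its nonzero values lie over []-oo, c']], which misses [K]. *)
    have [_ cphi _] := tphi; have [c' c'c hc'] := compact_lt cphi phic.
    exists `]-oo, c']%classic; split.
    * exact: interval_closed.
    * apply/seteqP; split=> x //= [+ /Kcd]; rewrite /= !in_itv/= => xc' /andP[cx _].
      by have := le_lt_trans (le_trans cx xc') c'c; rewrite ltxx.
    * move=> x /= /negP; rewrite in_itv/= -ltNge; apply: right_der_eq0 => y c'y.
      by apply: fsupp_eq0 => /hc'; rewrite leNgt c'y.
  + have sub : ~` `]d, +oo[ `<=` `]-oo, d]%classic.
      by move=> x /= /negP; rewrite !in_itv/= andbT -leNgt.
    apply: (@subset_trans _ (~` `]d, +oo[ `&` dom_set Omega)); last first.
      by move=> x [/sub xd Ox].
    apply: (dsupp_weak_der hu tpsi opL) => [|phi tphi phid].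
      exact: interval_open.
    (* Mirror image: the left derivative vanishes before [d'], and [[d', +oo[] misses [K]. *)
    have [_ cphi _] := tphi; have [d' dd' hd'] := compact_gt cphi phid.
    exists `[d', +oo[%classic; split.
    * exact: interval_closed.
    * apply/seteqP; split=> x //= [+ /Kcd]; rewrite /= !in_itv/= andbT => xd' /andP[_ dx].
      by have := lt_le_trans dd' (le_trans xd' dx); rewrite ltxx.
    * move=> x /= /negP; rewrite in_itv/= andbT -ltNge; apply: left_der_eq0 => y yd'.
      by apply: fsupp_eq0 => /hd'; rewrite leNgt yd'.
(* For a fixed [phi], all the [u_ j] are evaluated at the same test function [psi * D phi], so
   pointwise convergence carries over directly. *)
- move=> u_ _ cvgu; split=> phi tphi; apply: cvgMr; apply: cvgu.
  + by have [_ smD _] := opR; exact: testfunM tpsi (smD _ tphi).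
  + by have [_ smD _] := opL; exact: testfunM tpsi (smD _ tphi).
Qed.
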